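(* Let $q$ be a prime power and let $n,d,\ell$ be positive integers with $\ell\ge n$. Then $$A_q^{\mathrm{Lin}}(n,d)=\mathrm{val}\big(\mathrm{KrawtchoukLP}_{\mathrm{Lin}}^{\mathbb{F}_q}(n,d,\ell)\big)^{1/\ell}.$$
   Context: $\mathbb{F}_q$ is the finite field with $q$ elements. For $w\in\mathbb{F}_q^n$, $|w|$ is the Hamming weight (number of nonzero coordinates), and $[d-1]=\{1,\dots,d-1\}$. A linear code of blocklength $n$ is a linear subspace $\mathcal{C}\le\mathbb{F}_q^n$; it has minimum distance at least $d$ if no $w\in\mathcal{C}$ has $|w|\in[d-1]$ (the zero code satisfies this vacuously). $A_q^{\mathrm{Lin}}(n,d)$ is the maximum cardinality of a linear code $\mathcal{C}\le\mathbb{F}_q^n$ of minimum distance at least $d$. For $\alpha\in\mathbb{F}_q^n$, $\chi_\alpha\colon\mathbb{F}_q^n\to\mathbb{C}$ is the additive character associated with $\alpha$, $\chi_\alpha(x)=\exp\big(2\pi i\,\mathrm{Tr}_{\mathbb{F}_q/\mathbb{F}_p}(\sum_k\alpha_kx_k)/p\big)$, where $p$ is the characteristic of $\mathbb{F}_q$. For $\alpha=(\alpha_1,\dots,\alpha_\ell)$ and $x=(x_1,\dots,x_\ell)$ in $(\mathbb{F}_q^n)^\ell$, $\chi_\alpha(x)=\prod_{j=1}^\ell\chi_{\alpha_j}(x_j)$. $\mathrm{KrawtchoukLP}_{\mathrm{Lin}}^{\mathbb{F}_q}(n,d,\ell)$ is the following linear program in real variables $a_x$, $x\in(\mathbb{F}_q^n)^\ell$: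 maximize $\sum_{x\in(\mathbb{F}_q^n)^\ell}a_x$ subject to (1) $a_0=1$; (2) $a_{(x_1,\dots,x_\ell)}=0$ whenever there is $w\in\mathrm{span}(x_1,\dots,x_\ell)$ with $|w|\in[d-1]$; (3) $\sum_{x\in(\mathbb{F}_q^n)^\ell}a_x\chi_\alpha(x)\ge0$ for all $\alpha\in(\mathbb{F}_q^n)^\ell$; (4) $a_x=a_{-x}$ for all $x\in(\mathbb{F}_q^n)^\ell$; (5) $a_x\ge0$ for all $x\in(\mathbb{F}_q^n)^\ell$. $\mathrm{val}(\cdot)$ denotes the optimum value of a linear program. *)

(* Defs.v *)
From HB Require Import structures.
From mathcomp Require Import all_boot all_order all_algebra all_field.
From mathcomp Require Import all_classical all_reals all_analysis.
From mathcomp Require Import complex.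

Set Implicit Arguments.
Unset Strict Implicit.
Unset Printing Implicit Defensive.

Import Order.TTheory GRing.Theory Num.Theory.

Local Open Scope classical_set_scope.
Local Open Scope complex_scope.
Local Open Scope ring_scope.

(* A vector space over a finite field has finitely many subspaces, so that
   the maximum over all linear codes below can be written with [\max]. *)
Section FiniteVspace.
Import VectorInternalTheory.
HB.instance Definition _ (F : finFieldType) (V : vectType F) :=
  [Countable of {vspace V} by <:].
HB.instance Definition _ (F : finFieldType) (V : vectType F) :=
  [Finite of {vspace V} by <:].
End FiniteVspace.

Section Codes.
Variables (F : finFieldType) (n : nat).

Definition hamming_weight (w : 'rV[F]_n) : nat := #|[set k | w 0 k != 0]%SET|.

(* [hamming_weight w] lies in [[d - 1] = {1, ..., d - 1}]. *)
Definition low_weight (d : nat) (w : 'rV[F]_n) : bool :=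
  (1 <= hamming_weight w <= d.-1)%N.

Definition min_dist_geq (d : nat) (C : {vspace 'rV[F]_n}) : bool :=
  [forall w in C, ~~ low_weight d w].

Definition A_Lin (d : nat) : nat :=
  \max_(C : {vspace 'rV[F]_n} | min_dist_geq d C) #|C|.

End Codes.

Section Characters.
Variables (R : realType) (F : finFieldType).

Definition field_char : nat := s2val (finPcharP F).

Lemma field_char_pchar : field_char \in [pchar F].
Proof. exact: s2valP' (finPcharP F). Qed.

(* [F] viewed as an extension of its prime field ['F_p]. *)
Definition over_prime : splittingFieldType 'F_field_char :=
  pPrimeCharType field_char_pchar.

(* [galTrace] takes its values in the copy [1%AS] of ['F_p] inside [F]; its
   value is pulled back to the unique element of ['F_p] it is the image of. *)
Definition abs_trace (x : F) : 'F_field_char :=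
  odflt 0 [pick k : 'F_field_char |
             k%:A == galTrace 1%AS {:over_prime}%AS (x : over_prime)].

Lemma abs_traceE (x : F) :
  (abs_trace x)%:A = galTrace 1%AS {:over_prime}%AS x :> over_prime.
Proof.
rewrite /abs_trace; case: pickP => [k /eqP //|noK].
have G : galois (1%AS : {subfield over_prime}) {:over_prime}%AS.
  by apply: finField_galois; apply: sub1v.
have /vlineP[k Dk] := mem_galTrace G (memvf (x : over_prime)).
by have := noK k; rewrite Dk eqxx.
Qed.

Definition expi (t : R) : R[i] := cos t +i* sin t.

Definition chi n (alpha x : 'rV[F]_n) : R[i] :=
  expi (2 * pi * (abs_trace (\sum_k alpha 0 k * x 0 k) : nat)%:R
        / field_char%:R).

Definition chi_tuple n l (alpha x : {ffun 'I_l -> 'rV[F]_n}) : R[i] :=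
  \prod_(j < l) chi (alpha j) (x j).

End Characters.

Section KrawtchoukLP.
Variables (R : realType) (F : finFieldType) (n d l : nat).

Local Notation V := {ffun 'I_l -> 'rV[F]_n}.

(* In the third constraint, [0 <= z] in [R[i]] means that [z] is real and
   nonnegative. *)
Definition KrawtchoukLP_feasible (a : V -> R) : Prop :=
  [/\ a 0 = 1,
      forall x : V,
        (exists2 w, w \in <<codom x>>%VS & low_weight d w) -> a x = 0,
      forall alpha : V, 0 <= \sum_(x : V) (a x)%:C * chi_tuple R alpha x,
      forall x : V, a x = a (- x)
    & forall x : V, 0 <= a x].

Definition KrawtchoukLP_objective (a : V -> R) : R := \sum_(x : V) a x.

(* The supremum is taken in the extended reals, so that an unbounded or
   infeasible program has value [+oo] or [-oo]. *)
Definition KrawtchoukLP_val : \bar R :=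
  ereal_sup [set (KrawtchoukLP_objective a)%:E
            | a in [set a | KrawtchoukLP_feasible a]].

End KrawtchoukLP.

(* Main.v *)
(** Let [q] be the size of [F] and [q ^ k] that of the largest code of minimum
    distance at least [d].  The indicator function of [C ^ l], for [C] such a
    code, is feasible and has value [q ^ (k * l)].

    Conversely a feasible [a] lives on tuples whose span has dimension at most
    [k].  View tuples as [n * l] matrices over [F].  Since [n <= l] there is a
    Gabidulin code: the values, at [n] independent points of the extension [L]
    of degree [l] of [F], of the linearized polynomials
    [\sum_(i < n - k) c_i X ^ (q ^ i)] over [L].  Such a nonzero polynomial has
    fewer than [q ^ (n - k)] roots, so every nonzero codeword has rank more than
    [k], and [a] sums to [a 0 = 1] over the [q ^ (l * (n - k))] codewords.  By
    Poisson summation this sum is at least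
    [q ^ (l * (n - k)) / q ^ (n * l)] times the value of [a], all terms on the
    Fourier side being nonnegative. *)
Require Import Defs.
From HB Require Import structures.
From mathcomp Require Import all_boot all_order all_algebra all_field.
From mathcomp Require Import all_classical all_reals all_analysis.
From mathcomp Require Import complex.
From mathcomp Require Import ring lra.

Set Implicit Arguments.
Unset Strict Implicit.
Unset Printing Implicit Defensive.

Import Order.TTheory GRing.Theory Num.Theory.

Local Open Scope ring_scope.

(** * Finite field extensions of prescribed degree *)

(* The splitting field of [X ^ (q ^ k) - X]: its roots are the fixed points of
   the [k]-th power of the Frobenius, hence a subfield. *)
Lemma finField_extension_exists (F : finFieldType) k :
  (0 < k)%N -> {L : splittingFieldType F | \dim {:L} = k}.
Proof.
move=> k_gt0; pose m := (#|F| ^ k)%N.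
have F_gt1 := finNzRing_gt1 F.
have m_gt1 : (1 < m)%N by rewrite (ltn_exp2l 0).
pose q (R : nzRingType) : {poly R} := 'X^m - 'X.
have sz_q (R : nzRingType) : size (q R) = m.+1.
  by rewrite size_polyDl size_polyXn // size_polyN size_polyX.
have /FinSplittingFieldFor[/= L splitLq] : q F != 0.
  by rewrite -size_poly_gt0 sz_q.
exists L; rewrite [map_poly _ _]rmorphB rmorphXn /= map_polyX -/(q L) in splitLq.
have [p _ pcharF] := finPcharP F.
(* As [m] vanishes in [L], the derivative of [X ^ m - X] is -1, so its roots are distinct. *)
have mL0 : m%:R = 0 :> L.
  apply/eqP; rewrite -(dvdn_pcharf (p := p)) ?pchar_lalg //.
  rewrite /m (card_pprimeChar pcharF) -expnM dvdn_exp //.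
  rewrite muln_gt0 k_gt0 andbT lt0n; apply: contraTneq F_gt1 => e0.
  by rewrite (card_pprimeChar pcharF) e0.
have /finField_galois_generator[/= a _ Da] : (1 <= {:L})%VS by apply: sub1v.
pose Em := fixedSpace (a ^+ k)%g; rewrite /= dimv1 expn1 in Da.
have{splitLq} [zs DqL defL] := splitLq.
have Uzs : uniq zs.
  rewrite -separable_prod_XsubC -(eqp_separable DqL) unlock.
  rewrite derivB derivXn derivX -mulr_natr -polyC_natr mL0 polyC0 mulr0 sub0r.
  by rewrite coprimep_sym -scaleN1r coprimepZl ?coprime1p // oppr_eq0 oner_neq0.
have in_zs : zs =i Em.
  move=> z; rewrite -root_prod_XsubC -(eqp_root DqL) (sameP fixedSpaceP eqP).
  rewrite /root !hornerE subr_eq0 /= /m; congr (_ == z).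
  elim: (k) => [|i IHi]; first by rewrite gal_id.
  by rewrite expgSr expnSr exprM IHi galM ?Da ?memvf.
have defEm : Em = {:L}%VS.
  apply/eqP; rewrite eqEsubv subvf -defL -[Em]subfield_closed agenvS //.
  by rewrite subv_add sub1v; apply/span_subvP=> z; rewrite in_zs.
pose Fm := FinFieldExtType L.
(* All of [L] is fixed by [a ^+ k], so [L] consists of the [q ^ k] distinct roots; counting its
   elements gives the degree. *)
apply: (expnI F_gt1); rewrite -[RHS]/m -(@card_vspace F Fm).
have -> : #|({:L}%VS : {pred Fm})| = size zs.
  rewrite -(@card_uniqP Fm zs Uzs).
  by apply: eq_card => z; rewrite -[RHS]/(z \in (zs : seq L)) in_zs defEm.
apply: succn_inj; rewrite -(size_prod_XsubC _ id).
by rewrite -(eqp_size DqL) sz_q.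
Qed.

(** * Linearized polynomials and Gabidulin codes *)

Section Gabidulin.
Variables (F : finFieldType) (L : fieldExtType F).
Local Notation q := #|F|.

(** Coefficients are typed in [finvect_type L], a finite copy of [L], so that sums over all of them
    make sense. *)
Definition linearized m (c : {ffun 'I_m -> finvect_type L}) (u : L) : L :=
  \sum_(i < m) c i * u ^+ (q ^ i).

(** Each [q ^ i] is a power of the characteristic, so raising to it is additive; it fixes the
    scalars, since [a ^+ q = a] in [F]. *)
Lemma linearized_is_linear m c : linear (@linearized m c).
Proof.
move=> a u v; rewrite /linearized scaler_sumr -big_split; apply: eq_bigr => i _.
have [p _ pcharF] := finPcharP F.
have -> : (a *: u + v) ^+ (q ^ i) = (a *: u) ^+ (q ^ i) + v ^+ (q ^ i).
  apply: exprDn_pchar; rewrite (eq_pnat _ (pchar_lalg L)).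
  rewrite (eq_pnat _ (pcharf_eq pcharF)) (card_pprimeChar pcharF) -expnM.
  by rewrite pnatX pnat_id ?(pcharf_prime pcharF).
have -> : (a *: u) ^+ (q ^ i) = a *: u ^+ (q ^ i).
  rewrite exprZn; congr (_ *: _); elim: (val i) => // j IHj.
  by rewrite expnS exprM expf_card.
by rewrite mulrDr scalerAr.
Qed.

HB.instance Definition _ m c :=
  GRing.isLinear.Build F L L _ (@linearized m c) (linearized_is_linear c).

Lemma linearizedD m (c c' : {ffun 'I_m -> finvect_type L}) u :
  linearized (c + c') u = linearized c u + linearized c' u.
Proof.
by rewrite -big_split; apply: eq_bigr => i _; rewrite ffunE mulrDl.
Qed.

Lemma linearized_eq0 m (c : {ffun 'I_m -> finvect_type L}) (rs : seq L) :
  uniq rs -> {in rs, forall u, linearized c u = 0} -> (q ^ m <= size rs)%N ->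
  c = 0.
Proof.
move=> Urs rs0 le_rs; pose P : {poly L} := \sum_(i < m) c i *: 'X^(q ^ i).
have F_gt1 := finNzRing_gt1 F.
have szP : (size P <= q ^ m)%N.
  apply: (leq_trans (size_sum _ _ _)); apply/bigmax_leqP => i _.
  rewrite (leq_trans (size_scale_leq _ _)) // size_polyXn.
  by rewrite ltn_exp2l.
have P0 : P = 0.
  apply/eqP; apply: contraTT szP => nzP; rewrite -ltnNge.
  apply: (leq_ltn_trans le_rs); apply: max_poly_roots => //.
  apply/allP => u /rs0; rewrite /root /P horner_sum => u0; apply/eqP.
  rewrite -[RHS]u0 /linearized; apply: eq_bigr => i _.
  by rewrite hornerZ hornerXn.
apply/ffunP => i; rewrite ffunE.
(* The exponents [q ^ i] are distinct, so [c i] is the coefficient of [P] in degree [q ^ i]. *)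
have := congr1 (fun p : {poly L} => p`_(q ^ i)) P0.
rewrite coef0 /P coef_sum (bigD1 i) //= coefZ coefXn eqxx mulr1.
rewrite big1 ?addr0 // => j ne_ji; rewrite coefZ coefXn.
rewrite eqn_exp2l // eq_sym [_ == _](negbTE (_ : (j : nat) != i)) ?mulr0 //.
Qed.

Definition orthogonal_space n (U : {vspace 'rV[F]_n}) : {set 'rV[F]_n} :=
  [set u : 'rV_n | [forall w in U, \sum_i u 0 i * (w : 'rV_n) 0 i == 0]]%SET.

(** Pairing with a basis of [U] is a linear map to a space of dimension [\dim U]; rank-nullity
    bounds its kernel from below. *)
Lemma card_orthogonal_space n (U : {vspace 'rV[F]_n}) :
  (q ^ (n - \dim U) <= #|orthogonal_space U|)%N.
Proof.
pose B : 'M[F]_(\dim U, n) := \matrix_(j, i) (vbasis U)`_j 0 i.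
pose psi : 'Hom('rV[F]_n, 'rV[F]_(\dim U)) := linfun (mulmxr B^T).
have F_gt1 := finNzRing_gt1 F.
apply: (@leq_trans #|lker psi|).
  rewrite card_vspace leq_exp2l // leq_subLR.
  have dims := limg_ker_dim psi fullv.
  have dimF k : \dim {:'rV[F]_k} = k by rewrite dimvf /dim /= mul1n.
  rewrite capfv dimF in dims; rewrite -[X in (X <= _)%N]dims addnC leq_add2r.
  by rewrite (leq_trans (dimvS (subvf _))) // dimF.
apply: subset_leq_card; apply/fintype.subsetP => u; rewrite memv_ker lfunE /=.
move=> /eqP/rowP uB; rewrite inE; apply/forall_inP => w Uw.
rewrite (coord_vbasis Uw); apply/eqP.
under eq_bigr do rewrite summxE mulr_sumr.
rewrite exchange_big /= big1 // => j _.
transitivity (coord (vbasis U) j w * (u *m B^T) 0 j);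
  last by rewrite uB mxE mulr0.
rewrite mxE mulr_sumr; apply: eq_bigr => i _.
by rewrite !mxE mulrCA.
Qed.

Variable n : nat.
Hypothesis le_nL : (n <= \dim {:L})%N.

(** The evaluation points: [n] vectors of a basis of [L], hence independent over [F]. *)
Let g (i : 'I_n) : L := (vbasis {:L})`_(widen_ord le_nL i).

Definition gabidulin m (c : {ffun 'I_m -> finvect_type L}) :
    {ffun 'I_(\dim {:L}) -> 'rV[F]_n} :=
  [ffun j => \row_i coord (vbasis {:L}) j (linearized c (g i))].

Lemma gabidulinD m (c c' : {ffun 'I_m -> finvect_type L}) :
  gabidulin (c + c') = gabidulin c + gabidulin c'.
Proof.
apply/ffunP => j; rewrite !ffunE; apply/rowP => i.
by rewrite !mxE linearizedD linearD.
Qed.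

(* [u] is a linear dependency between the columns of the matrix [gabidulin c]
   iff the corresponding point of [L] is a root of [linearized c]. *)
Lemma gabidulin_dual m (c : {ffun 'I_m -> finvect_type L}) (u : 'rV[F]_n) :
  linearized c (\sum_i u 0 i *: g i) =
  \sum_j (\sum_i u 0 i * gabidulin c j 0 i) *: (vbasis {:L})`_j.
Proof.
rewrite linear_sum.
under [RHS]eq_bigr do rewrite scaler_suml.
rewrite [RHS]exchange_big; apply: eq_bigr => i _.
transitivity (u 0 i *: linearized c (g i)); first exact: linearZ.
rewrite {1}(coord_vbasis (memvf (linearized c (g i)))) scaler_sumr.
by apply: eq_bigr => j _; rewrite ffunE mxE scalerA.
Qed.

(** Vectors orthogonal to the span of the codeword give roots of [linearized c], distinct because
    the [g i] are independent. There are at least [q ^ m] of them, too many unless [c = 0]. *)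
Lemma gabidulin_rank m (c : {ffun 'I_m -> finvect_type L}) :
  (m + \dim <<codom (gabidulin c)>> <= n)%N -> c = 0.
Proof.
move=> le_mU; set U := (X in \dim X) in le_mU.
pose O := orthogonal_space U.
pose iota (u : 'rV[F]_n) : L := \sum_i u 0 i *: g i.
have iota_inj : injective iota.
  move=> u v eq_uv; apply/rowP => i.
  have coordg w : coord (vbasis {:L}) (widen_ord le_nL i) (iota w) = w 0 i.
    have freeL := basis_free (vbasisP {:L}).
    rewrite /iota linear_sum /= (bigD1 i) //= linearZ /= coord_free // eqxx.
    rewrite mulr1 big1 ?addr0 // => j ne_ji; rewrite linearZ /= coord_free //.
    by rewrite [_ == _](negbTE (_ : (j : nat) != i)) ?mulr0.
  by rewrite -!coordg eq_uv.
apply: (@linearized_eq0 m c (map iota (enum O))).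
- by rewrite map_inj_uniq ?enum_uniq.
- move=> _ /mapP[u Ou ->]; rewrite /iota gabidulin_dual big1 // => j _.
  move: Ou; rewrite mem_enum inE => /forall_inP Ou.
  rewrite (eqP (Ou (gabidulin c j) _)) ?scale0r //.
  exact/memv_span/codom_f.
- rewrite size_map -cardE; apply: leq_trans (card_orthogonal_space U).
  rewrite leq_exp2l ?finNzRing_gt1 // leq_subRL; first by rewrite addnC.
  exact: leq_trans (leq_addl _ _) le_mU.
Qed.

End Gabidulin.

(** * The absolute trace *)

Section AbsTrace.
Variable F : finFieldType.
Local Notation p := (field_char F).

Lemma field_char_prime : prime p.
Proof. exact: pcharf_prime (field_char_pchar F). Qed.

Lemma abs_traceD (x y : F) : abs_trace (x + y) = abs_trace x + abs_trace y.
Proof.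
apply: (fmorph_inj (in_alg (over_prime F))).
rewrite rmorphD /= !abs_traceE.
exact: (raddfD (galTrace 1%AS {:over_prime F}%AS) (x : over_prime F) y).
Qed.

(* Artin independence of the automorphisms in the trace. *)
Lemma abs_trace_neq0 : exists z : F, abs_trace z != 0.
Proof.
have [a _] := @gal_independent_contra _ (over_prime F) {:over_prime F}%AS
  [in 'Gal({:over_prime F} / 1)%g] (fun=> 1) _ (fingroup.group1 _) (oner_neq0 _).
under eq_bigr do rewrite mul1r.
rewrite -[\sum_(_ in _) _]/(galTrace 1%AS {:over_prime F}%AS a) -abs_traceE => nz.
by exists a; apply: contraNneq nz => ->; rewrite scale0r.
Qed.

End AbsTrace.

(** * Complex roots of unity *)

Section Expi.
Variable R : realType.

Lemma expiD (s t : R) : expi (s + t) = expi s * expi t.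
Proof.
by apply/eqP; rewrite eq_complex /= cosD sinD eqxx addrC /=; apply/eqP; ring.
Qed.

Lemma expi0 : expi 0 = 1 :> R[i].
Proof. by rewrite /expi cos0 sin0. Qed.

Definition root_unity (p k : nat) : R[i] := expi (2 * pi * k%:R / p%:R).

Lemma root_unityD p j k : root_unity p (j + k) = root_unity p j * root_unity p k.
Proof. by rewrite /root_unity natrD mulrDr mulrDl expiD. Qed.

Lemma root_unityMl p k : (0 < p)%N -> root_unity p (k * p) = 1.
Proof.
move=> p_gt0; rewrite /root_unity natrM mulrA mulfK ?pnatr_eq0 -?lt0n //.
elim: k => [|k IHk]; first by rewrite mulr0 expi0.
rewrite -(addn1 k) (natrD _ k) mulrDr expiD IHk mul1r mulr1 mulr_natl /expi.
by rewrite cos2pi sin2pi.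
Qed.

Lemma root_unity_mod p k : (0 < p)%N -> root_unity p (k %% p) = root_unity p k.
Proof.
by move=> p_gt0; rewrite [in RHS](divn_eq k p) root_unityD root_unityMl ?mul1r.
Qed.

(** The half angle [t] lies strictly between 0 and [pi], so [sin t > 0], whereas [cos (t + t) = 1]
    would force [sin t = 0]. *)
Lemma root_unity_neq1 p k : (0 < k < p)%N -> root_unity p k != 1.
Proof.
case/andP=> k_gt0 lt_kp; have p_gt0 := ltn_trans k_gt0 lt_kp.
set t : R := k%:R / p%:R * pi.
have t_gt0 : 0 < t by rewrite mulr_gt0 ?pi_gt0 // divr_gt0 ?ltr0n.
have t_ltpi : t < pi by rewrite gtr_pMl ?pi_gt0 // ltr_pdivrMr ?ltr0n // mul1r ltr_nat.
have sint : 0 < sin t by apply: sin_gt0_pi; rewrite t_gt0 t_ltpi.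
rewrite /root_unity; have -> : 2 * pi * k%:R / p%:R = t + t by rewrite /t; ring.
rewrite /expi cosD eq_complex negb_and /=; apply/orP; left.
apply: contraTneq sint => cc; rewrite -leNgt.
by have := cos2Dsin2 t; nra.
Qed.

End Expi.

(** * Sums of characters over subgroups *)

Section CharacterSums.
Variables (C : numDomainType) (I : finType) (P : pred I) (psi : I -> C).

(** Reindexing by [t] shows that the sum equals [z] times itself. *)
Lemma sum_translate_eq0 (t : I -> I) (z : C) :
  injective t -> (forall x, P (t x) = P x) ->
  (forall x, psi (t x) = z * psi x) -> z != 1 -> \sum_(x | P x) psi x = 0.
Proof.
move=> t_inj Pt psit z_neq1; set S := LHS.
have : S = z * S.
  rewrite {1}/S (reindex_inj t_inj) (eq_bigl _ _ Pt) mulr_sumr.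
  exact: eq_bigr.
move/eqP; rewrite -subr_eq0 -{1}[S]mul1r -mulrBl mulf_eq0 subr_eq0 eq_sym.
by rewrite (negbTE z_neq1) => /eqP.
Qed.

(** Either [psi] is 1 throughout [P] and the sum counts [P], or translation by some [y] with
    [psi y != 1] makes it vanish. *)
Lemma sum_character_ge0 (op : I -> I -> I) :
  (forall y, injective (op y)) -> (forall x y, P y -> P (op y x) = P x) ->
  (forall x y, psi (op y x) = psi y * psi x) -> 0 <= \sum_(x | P x) psi x.
Proof.
move=> op_inj Pop psiM.
have [/forall_inP triv|] := boolP [forall (y | P y), psi y == 1].
  by apply: sumr_ge0 => x /triv/eqP->.
case/forall_inPn => y Py psiy.
by rewrite (sum_translate_eq0 (op_inj y) (fun x => Pop x y Py) (psiM^~ y)).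
Qed.

End CharacterSums.

(** * Additive characters: bilinearity and orthogonality *)

Section Chi.
Variables (R : realType) (F : finFieldType).
Local Notation p := (field_char F).
Local Notation chi := (chi R).
Local Notation chi_tuple := (chi_tuple R).

Lemma chiE n (a x : 'rV[F]_n) :
  chi a x = root_unity R p (abs_trace (\sum_k a 0 k * x 0 k)).
Proof. by []. Qed.

Lemma chiD n (a x y : 'rV[F]_n) : chi a (x + y) = chi a x * chi a y.
Proof.
rewrite !chiE -root_unityD.
have p_gt0 := prime_gt0 (field_char_prime F).
rewrite -(root_unity_mod _ (_ + _) p_gt0).
have -> : \sum_k a 0 k * (x + y) 0 k = \sum_k a 0 k * x 0 k + \sum_k a 0 k * y 0 k.
  by rewrite -big_split; apply: eq_bigr => k _; rewrite mxE mulrDr.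
by rewrite abs_traceD /= [X in (_ %% X)%N]Fp_cast // field_char_prime.
Qed.

Lemma chiC n (a x : 'rV[F]_n) : chi a x = chi x a.
Proof. by rewrite !chiE; under eq_bigr do rewrite mulrC. Qed.

Lemma chi_tupleD n l (a x y : {ffun 'I_l -> 'rV[F]_n}) :
  chi_tuple a (x + y) = chi_tuple a x * chi_tuple a y.
Proof.
by rewrite -big_split; apply: eq_bigr => j _; rewrite ffunE chiD.
Qed.

Lemma chi_tupleC n l (a x : {ffun 'I_l -> 'rV[F]_n}) :
  chi_tuple a x = chi_tuple x a.
Proof. by apply: eq_bigr => j _; rewrite chiC. Qed.

Lemma chi0l n (x : 'rV[F]_n) : chi 0 x = 1.
Proof.
rewrite chiE big1 => [|k _]; last by rewrite mxE mul0r.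
have -> : abs_trace (0 : F) = 0.
  by apply: (addrI (abs_trace 0)); rewrite -abs_traceD !addr0.
by rewrite /root_unity mulr0 mul0r expi0.
Qed.

Lemma chi_tuple0l n l (x : {ffun 'I_l -> 'rV[F]_n}) : chi_tuple 0 x = 1.
Proof. by apply: big1 => j _; rewrite ffunE chi0l. Qed.

Lemma chi_tuple_nondegenerate n l (x : {ffun 'I_l -> 'rV[F]_n}) :
  x != 0 -> exists a, chi_tuple a x != 1.
Proof.
move=> nz_x; have [j nz_xj] : exists j, x j != 0.
  apply/existsP; apply: contraNT nz_x; rewrite negb_exists => /forallP x0.
  by apply/eqP/ffunP => j; rewrite ffunE; apply/eqP; rewrite -[_ == _]negbK.
have /rV0Pn[k nz_xjk] := nz_xj.
have [z nz_z] := abs_trace_neq0 F.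
(* Supported on one nonzero entry of [x] and scaled so that the pairing with [x] is [z], of nonzero
   trace. *)
exists [ffun j' => if j' == j then z / x j 0 k *: delta_mx 0 k else 0].
rewrite /Defs.chi_tuple (bigD1 j) //= big1 => [|j' ne_j'].
  rewrite mulr1 ffunE eqxx chiE (bigD1 k) //= big1 => [|k' ne_k'].
    rewrite !mxE !eqxx mulr1 divfK // addr0 root_unity_neq1 // lt0n nz_z /=.
    have := ltn_ord (abs_trace z).
    by rewrite [X in (_ < X)%N](_ : _ = p) // Fp_cast // field_char_prime.
  by rewrite !mxE (negbTE ne_k') andbF mulr0 mul0r.
by rewrite ffunE (negbTE ne_j') chi0l.
Qed.

Lemma chi_tuple_orthogonality n l (x : {ffun 'I_l -> 'rV[F]_n}) :
  \sum_a chi_tuple a x = ((x == 0) * (#|F| ^ (n * l)))%:R.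
Proof.
have [->|nz_x] := eqVneq x 0.
  under eq_bigr do rewrite chi_tupleC chi_tuple0l.
  by rewrite sumr_const cardT -cardE card_ffun card_mx card_ord mul1n expnM mul1n.
have [a nz_a] := chi_tuple_nondegenerate nz_x.
rewrite mul0n; apply: (sum_translate_eq0 (@addrI _ a)) nz_a => // b.
by rewrite !(chi_tupleC _ x) chi_tupleD.
Qed.

End Chi.

(** * Codes of maximum size *)

Lemma dim_rowspace (F : fieldType) n (C : {vspace 'rV[F]_n}) : (\dim C <= n)%N.
Proof. by rewrite (leq_trans (dimvS (subvf C))) // dimvf /dim /= mul1n. Qed.

Lemma A_Lin_attained (F : finFieldType) n d :
  {C : {vspace 'rV[F]_n} | min_dist_geq d C & A_Lin F n d = (#|F| ^ \dim C)%N}.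
Proof.
have [|C goodC AC] := @eq_bigmax_cond _ (@min_dist_geq F n d) (fun C => #|C|).
  apply/card_gt0P; exists 0%VS; apply/forall_inP => w; rewrite memv0 => /eqP->.
  rewrite /low_weight /hamming_weight (_ : [set _ | _]%SET = finset.set0) ?cards0 //.
  by apply/setP => k; rewrite !inE mxE eqxx.
by exists C => //; rewrite -card_vspace -AC.
Qed.

(** * Upper and lower bounds on the linear program *)

Section LPBounds.
Variables (R : realType) (F : finFieldType) (n d : nat).
Local Notation feasible := (@KrawtchoukLP_feasible R F n d _).
Local Open Scope complex_scope.

(** By the second constraint, the span of a tuple in the support is itself a code of minimum
    distance at least [d]. *)
Lemma feasible_support l (a : {ffun 'I_l -> 'rV[F]_n} -> R) x :
  feasible a -> a x != 0 -> (#|F| ^ \dim <<codom x>> <= A_Lin F n d)%N.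
Proof.
move=> [_ a0 _ _ _] nz_ax.
rewrite -card_vspace /A_Lin; apply: leq_bigmax_cond; apply/forall_inP => w xw.
by apply: contraNN nz_ax => lw; apply/eqP/a0; exists w.
Qed.

(** The tuple length is written [\dim {:L}] so that Gabidulin codewords have the type of the
    arguments of [a]. *)
Lemma feasible_objective_le (L : fieldExtType F) k
    (a : {ffun 'I_(\dim {:L}) -> 'rV[F]_n} -> R) :
  (n <= \dim {:L})%N -> (k <= n)%N -> feasible a ->
  (forall x, a x != 0 -> (\dim <<codom x>> <= k)%N) ->
  KrawtchoukLP_objective a <= (#|F| ^ (k * \dim {:L}))%:R.
Proof.
move=> le_nL le_kn [a0 _ ahat_ge0 aN _] supp_a.
set l := \dim {:L} in a ahat_ge0 a0 aN supp_a le_nL *.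
pose M : finType := {ffun 'I_(n - k) -> finvect_type L}.
pose phi (c : M) : {ffun 'I_l -> 'rV[F]_n} := gabidulin le_nL c.
pose ahat al : R[i] := \sum_x (a x)%:C * chi_tuple R al x.
pose S al : R[i] := \sum_(c : M) chi_tuple R al (phi c).
have S_ge0 al : 0 <= S al.
  apply: (sum_character_ge0 (op := fun c c' : M => c + c')) => // c c'.
  by rewrite /phi gabidulinD chi_tupleD.
(* Nonzero codewords have rank more than [k], outside the support of [a]. The sign, absorbed by the
   symmetry of [a], comes from solving [x + phi c = 0] below. *)
have a_phi c : a (- phi c) = (c == 0 :> {ffun 'I_(n - k) -> finvect_type L})%:R.
  rewrite -aN; have [->|nz_c] := eqVneq.
    rewrite (_ : phi 0 = 0) //.
    by apply: (addrI (phi 0)); rewrite -gabidulinD !addr0.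
  apply: contraNeq nz_c => /supp_a le_k; apply/eqP.
  apply: (@gabidulin_rank _ _ _ le_nL).
  by rewrite -leq_subRL ?leq_subr // subKn.
have poisson : \sum_al ahat al * S al = (#|F| ^ (n * l))%:R.
  transitivity
      (\sum_(c : M) \sum_x (a x)%:C * \sum_al chi_tuple R al (x + phi c)).
    under [RHS]eq_bigr do under eq_bigr do rewrite mulr_sumr.
    under [RHS]eq_bigr do rewrite exchange_big.
    rewrite [RHS]exchange_big; apply: eq_bigr => al _.
    rewrite /ahat /S mulr_sumr; apply: eq_bigr => c _.
    rewrite mulr_suml; apply: eq_bigr => x _.
    by rewrite chi_tupleD mulrA.
  under eq_bigr do under eq_bigr do rewrite chi_tuple_orthogonality.
  transitivity (\sum_(c : M) (a (- phi c))%:C * (#|F| ^ (n * l))%:R).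
    apply: eq_bigr => c _; rewrite (bigD1 (- phi c)) //= addNr eqxx mul1n.
    by rewrite big1 ?addr0 // => x ne_x; rewrite addr_eq0 (negbTE ne_x) mulr0.
  under eq_bigr do rewrite a_phi.
  rewrite (bigD1 (0 : {ffun 'I_(n - k) -> finvect_type L})) //= eqxx mul1r.
  rewrite big1 ?addr0 // => c nz_c.
  by rewrite (negbTE nz_c) mul0r.
have ahat0 : ahat 0 = (KrawtchoukLP_objective a)%:C.
  rewrite /ahat /KrawtchoukLP_objective rmorph_sum.
  by apply: eq_bigr => x _; rewrite chi_tuple0l mulr1.
have S0 : S 0 = (#|F| ^ ((n - k) * l))%:R.
  rewrite /S; under eq_bigr do rewrite chi_tuple0l.
  rewrite sumr_const cardT -cardE card_ffun card_ord.
  have -> : #|finvect_type L| = (#|F| ^ l)%N.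
    rewrite -(@card_vspace F (finvect_type L)).
    by apply: eq_card => x; apply/esym/memvf.
  by rewrite -expnM mulnC.
have q_gt0 : (0 < #|F|)%N by apply: ltnW (finNzRing_gt1 F).
(* After scaling by the number of codewords, the left side is the term of [poisson] at the trivial
   character; the other terms are nonnegative. *)
rewrite -(ler_pM2r (_ : 0 < (#|F| ^ ((n - k) * l))%:R)) ?ltr0n ?expn_gt0 ?q_gt0 //.
rewrite -natrM -expnD -mulnDl subnKC // -lecR rmorphM !rmorph_nat /= -ahat0 -S0.
rewrite -poisson (bigD1 (0 : {ffun 'I_l -> 'rV[F]_n})) //= lerDl.
apply: sumr_ge0 => al _.
exact: mulr_ge0 (ahat_ge0 al) (S_ge0 al).
Qed.

Lemma code_power_feasible l (C : {vspace 'rV[F]_n}) :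
  min_dist_geq d C ->
  feasible (fun x : {ffun 'I_l -> 'rV[F]_n} => (x \in ffun_on (mem C))%:R).
Proof.
move=> /forall_inP goodC; split=> [|x [w xw lw]|al|x|x].
- by rewrite (_ : _ \in _) //; apply/ffun_onP => j; rewrite ffunE mem0v.
- case: ffun_onP => // xC; suff /goodC : w \in C by rewrite lw.
  by apply: subvP xw; apply/span_subvP => _ /codomP[j ->]; apply: xC.
(* The Fourier coefficient is a character sum over the subgroup [C ^ l]. *)
- under eq_bigr do rewrite rmorph_nat mulr_natl mulrb.
  rewrite -big_mkcond.
  pose add (c x : {ffun 'I_l -> 'rV[F]_n}) := c + x.
  apply: (sum_character_ge0 (op := add)) => [c|x c cC|x c].
  + exact: addrI.
  + apply/ffun_onP/ffun_onP => xC j; last first.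
      by rewrite ffunE rpredD //; apply/ffun_onP: j.
    have := xC j; rewrite ffunE rpredDl //.
    by apply/ffun_onP: j.
  + exact: chi_tupleD.
- congr (nat_of_bool _)%:R; apply/ffun_onP/ffun_onP => xC j.
    by rewrite ffunE rpredN.
  by have := xC j; rewrite ffunE rpredN.
- exact: ler0n.
Qed.

Lemma code_power_objective l (C : {vspace 'rV[F]_n}) :
  KrawtchoukLP_objective
    (fun x : {ffun 'I_l -> 'rV[F]_n} => (x \in ffun_on (mem C))%:R) =
  (#|C| ^ l)%:R :> R.
Proof.
rewrite /KrawtchoukLP_objective; under eq_bigr do rewrite mulrb.
by rewrite -big_mkcond sumr_const card_ffun_on card_ord.
Qed.

End LPBounds.

Theorem theorem1p2 (R : realType) (F : finFieldType) (n d l : nat)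
    (n_gt0 : (0 < n)%N) (d_gt0 : (0 < d)%N) (l_gt0 : (0 < l)%N)
    (le_nl : (n <= l)%N) :
  ((A_Lin F n d)%:R%:E =
     poweR (KrawtchoukLP_val R F n d l) (l%:R^-1) :> \bar R)%E.
Proof.
have [C goodC AC] := A_Lin_attained F n d.
suff -> : KrawtchoukLP_val R F n d l = ((#|F| ^ (\dim C * l))%:R)%:E.
  rewrite poweR_EFin expnM -AC natrX -powR_mulrn ?ler0n // -powRrM mulfV.
    by rewrite powRr1 // ler0n.
  by rewrite pnatr_eq0 -lt0n.
apply/eqP; rewrite eq_le; apply/andP; split.
  apply: ge_ereal_sup => _ [a feas_a <-]; rewrite lee_fin.
  (* Replacing [l] by the degree of [L] identifies the tuples of the program with those of the
     Gabidulin code. *)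
  have [L dimL] := finField_extension_exists F l_gt0; subst l.
  apply: (feasible_objective_le le_nl (dim_rowspace C) feas_a) => x.
  move=> /(feasible_support feas_a); rewrite AC leq_exp2l //.
  exact: finNzRing_gt1.
apply: ereal_sup_ubound.
exists (fun x => (x \in ffun_on (mem C))%:R); first exact: code_power_feasible.
by rewrite code_power_objective card_vspace expnM.
Qed.
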